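(* Let $K$ be a group, let $(PQR): P\xrightarrow{\bar\jmath}Q\xrightarrow{\bar\phi}R$ be a group extension, let $\theta:Q\to\mathrm{Out}(K)$ be an outer action, let $(G,i,\pi)$ be an extension of $K$ by $Q$ with outer action $\theta$, and let $(N,i_0,\pi_0)$ be its $P$-subextension. Then the bijection $-\boxtimes G$, $[e]\mapsto(e\boxtimes G,i,\pi)$, from $H^2(Q,Z(K))$ to the set of isomorphism classes of extensions of $K$ by $Q$ with outer action $\theta$ restricts to a bijection $$-\boxtimes G:\ H^2_P(Q,Z(K))\xrightarrow{\ \simeq\ }\left\{\begin{array}{l}\text{isomorphism classes of extensions of }K\text{ by }Q\text{ with outer action }\theta\\ \text{whose }P\text{-subextension is isomorphic to }(N,i_0,\pi_0)\end{array}\right\}.$$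
   Context: Conventions. For a group $H$ and an $H$-module $A$ (multiplicative), cochains are normalized (trivial value whenever an argument is the identity); $Z^2(H,A)$ is the group of normalized maps $d:H\times H\to A$ with $d(h_1,h_2)d(h_1h_2,h_3)={}^{h_1}d(h_2,h_3)d(h_1,h_2h_3)$, $B^2(H,A)$ consists of the maps $\partial z(h_1,h_2)=z(h_1)\cdot{}^{h_1}z(h_2)\cdot z(h_1h_2)^{-1}$ with $z:H\to A$, $z(1)=1$, and $H^2=Z^2/B^2$. An extension of $K$ by $Q$ is a triple $(G,i,\pi)$ with $i:K\to G$ injective and $\pi:G\to Q$ surjective homomorphisms, $i(K)=\mathrm{Ker}(\pi)$; $K$ is identified with $i(K)$ and $P$ with $\bar\jmath(P)\subseteq Q$. Two extensions $(G_\ell,i_\ell,\pi_\ell)$ are isomorphic iff there is a group isomorphism $\varphi:G_1\to G_2$ with $\varphi\circ i_1=i_2$ and $\pi_2\circ\varphi=\pi_1$. Conjugation of $G$ on $K$ induces a homomorphism $Q\to\mathrm{Out}(K)=\mathrm{Aut}(K)/\mathrm{Inn}(K)$, the outer action of the extension. $Q$ (and $P$, by restriction) acts on the centre $Z(K)$ via $\theta$. The $P$-subextension of $(G,i,\pi)$ is the extension $(N,i_0,\pi_0)$ of $K$ by $P$ with $N:=\pi^{-1}(P)$ and $i_0,\pi_0$ induced by $i,\pi$. For $e\in Z^2(Q,Z(K))$, $e\boxtimes G$ is the set $G$ with multiplication $(g_1,g_2)\mapsto e(\pi(g_1),\pi(g_2))\cdot g_1\cdot g_2$; it is a group and $(e\boxtimes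 G,i,\pi)$ is an extension of $K$ by $Q$ with outer action $\theta$, whose isomorphism class depends only on $[e]\in H^2(Q,Z(K))$. $H^2_P(Q,Z(K)):=\mathrm{Ker}\bigl(H^2(Q,Z(K))\xrightarrow{\mathrm{res}}H^2(P,Z(K))\bigr)$. *)

(* Defs.v *)
From HB Require Import structures.
From mathcomp Require Import all_boot.
From mathcomp Require Import boolp classical_sets functions.

Set Implicit Arguments.
Unset Strict Implicit.
Unset Printing Implicit Defensive.

Local Open Scope classical_set_scope.
Local Open Scope group_scope.
Local Open Scope quotient_scope.

Notation "{ 'hom' G -> H }" :=
  (UMagmaMorphism.type G H) (at level 0, G at level 98, H at level 99,
   format "{ 'hom'  G  ->  H }") : type_scope.

Record normalSubgroup (G : groupType) := NormalSubgroup {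
  nsub :> G -> Prop;
  nsub1 : nsub 1;
  nsubM : forall x y, nsub x -> nsub y -> nsub (x * y);
  nsubV : forall x, nsub x -> nsub x^-1;
  nsubJ : forall x y, nsub x -> nsub (x ^ y) }.

Section QuotientGroup.
Variables (G : groupType) (N : normalSubgroup G).

Definition coset_rel : rel G := fun x y => `[< N (x^-1 * y) >].

Lemma coset_relP x y : reflect (N (x^-1 * y)) (coset_rel x y).
Proof. exact: asboolP. Qed.

Lemma coset_rel_refl : reflexive coset_rel.
Proof. by move=> x; apply/coset_relP; rewrite mulVg; apply: nsub1. Qed.

Lemma coset_rel_sym : symmetric coset_rel.
Proof.
suff H x y : coset_rel x y -> coset_rel y x by move=> x y; apply/idP/idP; apply: H.
by move=> /coset_relP /nsubV; rewrite invgM invgK => ?; apply/coset_relP.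
Qed.

Lemma coset_rel_trans : transitive coset_rel.
Proof.
move=> y x z /coset_relP xy /coset_relP yz; apply/coset_relP.
by have := nsubM xy yz; rewrite mulgA mulgK.
Qed.

Canonical coset_equiv := EquivRel coset_rel
  coset_rel_refl coset_rel_sym coset_rel_trans.

Definition quotG : Type := {eq_quot coset_equiv}.
HB.instance Definition _ := Choice.on quotG.
HB.instance Definition _ := EqQuotient.on quotG.

Definition qproj (x : G) : quotG := \pi_quotG x.
Definition qrepr (a : quotG) : G := repr a.

Lemma qreprK : cancel qrepr qproj.
Proof. exact: reprK. Qed.

Lemma qprojW (S : quotG -> Prop) : (forall x, S (qproj x)) -> forall a, S a.
Proof. by move=> Sx a; rewrite -[a]qreprK. Qed.

Lemma qproj_eqP x y : (qproj x = qproj y) <-> N (x^-1 * y).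
Proof.
by split=> [/eqquotP/coset_relP //|xy]; apply/eqquotP/coset_relP.
Qed.

Lemma qprojP x : N (x^-1 * qrepr (qproj x)).
Proof. by apply/qproj_eqP; rewrite qreprK. Qed.

Definition quotG_one : quotG := qproj 1.
Definition quotG_mul (a b : quotG) : quotG := qproj (qrepr a * qrepr b).
Definition quotG_inv (a : quotG) : quotG := qproj (qrepr a)^-1.

Lemma quotG_mulE x y : quotG_mul (qproj x) (qproj y) = qproj (x * y).
Proof.
apply: esym; apply/qproj_eqP; move: (qprojP x) (qprojP y).
set x' := qrepr _; set y' := qrepr _ => Nx Ny.
have -> : (x * y)^-1 * (x' * y') = (x^-1 * x') ^ y * (y^-1 * y').
  by rewrite conjgE invgM !mulgA mulgK.
exact: nsubM (nsubJ _ Nx) Ny.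
Qed.

Lemma quotG_invE x : quotG_inv (qproj x) = qproj x^-1.
Proof.
apply: esym; apply/qproj_eqP; move: (qprojP x); set x' := qrepr _ => Nx.
rewrite invgK; have -> : x * x'^-1 = ((x^-1 * x')^-1) ^ x^-1.
  by rewrite conjgE invgM !invgK !mulgA mulgK.
exact/nsubJ/nsubV.
Qed.

Fact quotG_mulA : associative quotG_mul.
Proof.
elim/qprojW=> x; elim/qprojW=> y; elim/qprojW=> z.
by rewrite !quotG_mulE mulgA.
Qed.
Fact quotG_mul1 : left_id quotG_one quotG_mul.
Proof. by elim/qprojW=> x; rewrite quotG_mulE mul1g. Qed.
Fact quotG_1mul : right_id quotG_one quotG_mul.
Proof. by elim/qprojW=> x; rewrite quotG_mulE mulg1. Qed.
Fact quotG_mulV : left_inverse quotG_one quotG_inv quotG_mul.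
Proof. by elim/qprojW=> x; rewrite quotG_invE quotG_mulE mulVg. Qed.
Fact quotG_Vmul : right_inverse quotG_one quotG_inv quotG_mul.
Proof. by elim/qprojW=> x; rewrite quotG_invE quotG_mulE mulgV. Qed.

HB.instance Definition _ := isGroup.Build quotG
  quotG_mulA quotG_mul1 quotG_1mul quotG_mulV quotG_Vmul.

Fact qproj_hom : monoid_morphism qproj.
Proof. by split=> // x y; rewrite -quotG_mulE. Qed.
HB.instance Definition _ := isUMagmaMorphism.Build _ _ qproj qproj_hom.

Lemma qproj1 : qproj 1 = 1. Proof. exact: gmulf1. Qed.
Lemma qprojM x y : qproj (x * y) = qproj x * qproj y. Proof. exact: gmulfM. Qed.

End QuotientGroup.

Section Automorphisms.
Variable K : groupType.

Definition is_aut : pred (K -> K) :=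
  fun f => `[< {morph f : x y / x * y} /\ bijective f >].

Record Aut : Type := MkAut { aut_fun :> K -> K; autP : is_aut aut_fun }.

HB.instance Definition _ := [isSub for aut_fun].
HB.instance Definition _ := [Choice of Aut by <:].

Lemma autM (f : Aut) : {morph f : x y / x * y}.
Proof. by case: f => f /= /asboolP[]. Qed.

Lemma aut_bij (f : Aut) : bijective f.
Proof. by case: f => f /= /asboolP[]. Qed.

Fact aut_hom (f : Aut) : monoid_morphism f.
Proof.
split; last exact: autM.
by apply: (mulgI (f 1)); rewrite -autM !mulg1.
Qed.
HB.instance Definition _ (f : Aut) :=
  isUMagmaMorphism.Build K K f (aut_hom f).

Lemma aut_eqP (f g : Aut) : f =1 g -> f = g.
Proof. by move=> fg; apply: val_inj; apply: funext. Qed.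

Fact aut_one_subproof : is_aut idfun.
Proof. by apply/asboolP; split=> //; exists idfun. Qed.
Definition aut_one := MkAut aut_one_subproof.

Fact aut_mul_subproof (f g : Aut) : is_aut (f \o g).
Proof.
apply/asboolP; split; first by move=> x y /=; rewrite !autM.
exact: bij_comp (aut_bij f) (aut_bij g).
Qed.
Definition aut_mul (f g : Aut) := MkAut (aut_mul_subproof f g).

Fact aut_inv_exists (f : Aut) : exists g : Aut, cancel f g /\ cancel g f.
Proof.
have [g fg gf] := aut_bij f.
have autg : is_aut g.
  apply/asboolP; split; last by exists f.
  by move=> x y; apply: (can_inj fg); rewrite autM !gf.
by exists (MkAut autg).
Qed.
Definition aut_inv (f : Aut) : Aut := sval (cid (aut_inv_exists f)).

Lemma aut_invK (f : Aut) : cancel f (aut_inv f).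
Proof. by rewrite /aut_inv; case: cid => g []. Qed.
Lemma aut_invVK (f : Aut) : cancel (aut_inv f) f.
Proof. by rewrite /aut_inv; case: cid => g []. Qed.

Fact aut_mulA : associative aut_mul.
Proof. by move=> f g h; apply: aut_eqP. Qed.
Fact aut_mul1 : left_id aut_one aut_mul.
Proof. by move=> f; apply: aut_eqP. Qed.
Fact aut_1mul : right_id aut_one aut_mul.
Proof. by move=> f; apply: aut_eqP. Qed.
Fact aut_mulV : left_inverse aut_one aut_inv aut_mul.
Proof. by move=> f; apply: aut_eqP => x /=; rewrite aut_invK. Qed.
Fact aut_Vmul : right_inverse aut_one aut_inv aut_mul.
Proof. by move=> f; apply: aut_eqP => x /=; rewrite aut_invVK. Qed.

HB.instance Definition _ := isGroup.Build Aut
  aut_mulA aut_mul1 aut_1mul aut_mulV aut_Vmul.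

Lemma autME (f g : Aut) x : (f * g) x = f (g x). Proof. by []. Qed.
Lemma aut1E x : (1 : Aut) x = x. Proof. by []. Qed.

Definition inner_set : set Aut :=
  [set f | exists a : K, forall x, f x = a * x * a^-1].

Fact inner1 : inner_set 1.
Proof. by exists 1 => x; rewrite mul1g invg1 mulg1. Qed.
Fact innerM f g : inner_set f -> inner_set g -> inner_set (f * g).
Proof.
move=> [a fa] [b gb]; exists (a * b) => x.
by rewrite autME fa gb invgM !mulgA.
Qed.
Fact innerV f : inner_set f -> inner_set f^-1.
Proof.
move=> [a fa]; exists a^-1 => x; apply: (can_inj (aut_invK f)).
by rewrite aut_invVK fa invgK !mulgA mulgV mul1g mulgK.
Qed.
Fact innerJ f g : inner_set f -> inner_set (f ^ g).
Proof.
move=> [a fa]; exists (aut_inv g a) => x; rewrite conjgE !autME fa.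
rewrite -[LHS]/(aut_inv g (a * g x * a^-1)) !autM aut_invK.
by rewrite gmulfV.
Qed.

Definition Inn : normalSubgroup Aut :=
  NormalSubgroup inner1 innerM innerV innerJ.

Definition Out : groupType := quotG Inn.

End Automorphisms.

Record gmodule (H : groupType) := GModule {
  gm_sort :> groupType;
  gm_comm : forall x y : gm_sort, x * y = y * x;
  gm_act : {hom H -> Aut gm_sort} }.

Definition act (H : groupType) (A : gmodule H) (h : H) (a : A) : A :=
  gm_act A h a.

Definition res_module (P Q : groupType) (j : {hom P -> Q}) (A : gmodule Q) :
  gmodule P := GModule (@gm_comm Q A) (gm_act A \o j : {hom P -> Aut A}).

Section Cohomology.
Variables (H : groupType) (A : gmodule H).
Local Notation "h • a" := (act h a) (at level 35, right associativity).

Lemma actM h (a b : A) : h • (a * b) = h • a * h • b.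
Proof. exact: gmulfM. Qed.
Lemma act1 h : h • (1 : A) = 1.
Proof. exact: gmulf1. Qed.
Lemma actV h (a : A) : h • a^-1 = (h • a)^-1.
Proof. exact: gmulfV. Qed.
Lemma act_mul h k (a : A) : (h * k) • a = h • k • a.
Proof. by rewrite /act gmulfM. Qed.
Lemma act_one (a : A) : 1 • a = a.
Proof. by rewrite /act gmulf1. Qed.
Lemma gm_mulACA (a b c d : A) : a * b * (c * d) = a * c * (b * d).
Proof. by rewrite !mulgA -[a * b * c]mulgA (gm_comm b) mulgA. Qed.

Definition cocycle2 : pred (H -> H -> A) := fun d => `[<
  [/\ forall h, d 1 h = 1, forall h, d h 1 = 1 &
   forall h1 h2 h3, d h1 h2 * d (h1 * h2) h3 = h1 • d h2 h3 * d h1 (h2 * h3)] >].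

Record Z2 : Type := MkZ2 { z2_fun :> H -> H -> A; z2P : cocycle2 z2_fun }.

HB.instance Definition _ := [isSub for z2_fun].
HB.instance Definition _ := [Choice of Z2 by <:].

Lemma z21l (d : Z2) h : d 1 h = 1.
Proof. by case: d => d /= /asboolP[]. Qed.
Lemma z21r (d : Z2) h : d h 1 = 1.
Proof. by case: d => d /= /asboolP[]. Qed.
Lemma z2E (d : Z2) h1 h2 h3 :
  d h1 h2 * d (h1 * h2) h3 = h1 • d h2 h3 * d h1 (h2 * h3).
Proof. by case: d => d /= /asboolP[]. Qed.
Lemma z2_eqP (d e : Z2) : (forall h k, d h k = e h k) -> d = e.
Proof.
by move=> de; apply: val_inj; apply: funext => h; apply: funext => k; apply: de.
Qed.

Fact z2_one_subproof : cocycle2 (fun _ _ => 1).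
Proof. by apply/asboolP; split=> // *; rewrite act1. Qed.
Definition z2_one := MkZ2 z2_one_subproof.

Fact z2_mul_subproof (d e : Z2) : cocycle2 (fun h k => d h k * e h k).
Proof.
apply/asboolP; split=> [h|h|h1 h2 h3]; rewrite ?z21l ?z21r ?mul1g //.
by rewrite gm_mulACA !z2E actM gm_mulACA.
Qed.
Definition z2_mul (d e : Z2) := MkZ2 (z2_mul_subproof d e).

Fact z2_inv_subproof (d : Z2) : cocycle2 (fun h k => (d h k)^-1).
Proof.
apply/asboolP; split=> [h|h|h1 h2 h3]; rewrite ?z21l ?z21r ?invg1 //.
by rewrite actV -!invgM gm_comm z2E gm_comm.
Qed.
Definition z2_inv (d : Z2) := MkZ2 (z2_inv_subproof d).

Fact z2_mulA : associative z2_mul.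
Proof. by move=> d e f; apply: z2_eqP => h k /=; rewrite mulgA. Qed.
Fact z2_mul1 : left_id z2_one z2_mul.
Proof. by move=> d; apply: z2_eqP => h k /=; rewrite mul1g. Qed.
Fact z2_1mul : right_id z2_one z2_mul.
Proof. by move=> d; apply: z2_eqP => h k /=; rewrite mulg1. Qed.
Fact z2_mulV : left_inverse z2_one z2_inv z2_mul.
Proof. by move=> d; apply: z2_eqP => h k /=; rewrite mulVg. Qed.
Fact z2_Vmul : right_inverse z2_one z2_inv z2_mul.
Proof. by move=> d; apply: z2_eqP => h k /=; rewrite mulgV. Qed.

HB.instance Definition _ := isGroup.Build Z2
  z2_mulA z2_mul1 z2_1mul z2_mulV z2_Vmul.

Lemma z2M (d e : Z2) h k : (d * e) h k = d h k * e h k. Proof. by []. Qed.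
Lemma z2V (d : Z2) h k : d^-1 h k = (d h k)^-1. Proof. by []. Qed.

Definition coboundary_set : set Z2 :=
  [set d | exists z : H -> A, z 1 = 1 /\
    forall h1 h2, d h1 h2 = z h1 * h1 • z h2 * (z (h1 * h2))^-1].

Fact coboundary1 : coboundary_set 1.
Proof. by exists (fun=> 1); split=> // h k; rewrite act1 !mul1g invg1. Qed.
Fact coboundaryM d e :
  coboundary_set d -> coboundary_set e -> coboundary_set (d * e).
Proof.
move=> [z [z1 dz]] [w [w1 ew]]; exists (fun h => z h * w h).
split=> [|h k]; first by rewrite z1 w1 mulg1.
rewrite z2M dz ew invgM actM (gm_comm (w _)^-1).
by rewrite [in RHS](gm_mulACA (z h)) [RHS]gm_mulACA.
Qed.
Fact coboundaryV d : coboundary_set d -> coboundary_set d^-1.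
Proof.
move=> [z [z1 dz]]; exists (fun h => (z h)^-1).
split=> [|h k]; first by rewrite z1 invg1.
by rewrite z2V dz !invgM actV gm_comm (gm_comm (h • _)^-1).
Qed.
Fact coboundaryJ d e : coboundary_set d -> coboundary_set (d ^ e).
Proof.
suff -> : d ^ e = d by [].
by apply: z2_eqP => h k; rewrite conjgE !z2M z2V (gm_comm (d _ _)) mulKg.
Qed.

Definition B2 : normalSubgroup Z2 :=
  NormalSubgroup coboundary1 coboundaryM coboundaryV coboundaryJ.

Definition H2 : groupType := quotG B2.

End Cohomology.

Section Restriction.
Variables (P Q : groupType) (j : {hom P -> Q}) (A : gmodule Q).

Fact res_Z2_subproof (d : Z2 A) :
  cocycle2 (fun p1 p2 => d (j p1) (j p2) : res_module j A).
Proof.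
apply/asboolP; split=> [h|h|h1 h2 h3]; rewrite ?gmulf1 ?z21l ?z21r //.
by rewrite !gmulfM; exact: (z2E d (j h1) (j h2) (j h3)).
Qed.
Definition res_Z2 (d : Z2 A) : Z2 (res_module j A) := MkZ2 (res_Z2_subproof d).

(* [res_H2E] shows that the representative is irrelevant. *)
Definition res_H2 (x : H2 A) : H2 (res_module j A) := qproj _ (res_Z2 (qrepr x)).

Lemma res_H2E (d : Z2 A) : res_H2 (qproj _ d) = qproj _ (res_Z2 d).
Proof.
apply: esym; apply/qproj_eqP.
have [z [z1 dz]] := qprojP (B2 A) d; exists (fun p => z (j p)).
split=> [|p q]; first by rewrite gmulf1.
have := dz (j p) (j q); rewrite -gmulfM; exact.
Qed.

Fact res_H2_hom : monoid_morphism res_H2.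
Proof.
split; first by rewrite -[1 in LHS]qproj1 res_H2E; congr (qproj _ _); apply: z2_eqP.
elim/qprojW=> d; elim/qprojW=> e; rewrite -qprojM !res_H2E -qprojM.
by congr (qproj _ _); apply: z2_eqP.
Qed.
HB.instance Definition _ := isUMagmaMorphism.Build _ _ res_H2 res_H2_hom.

Definition H2rel : set (H2 A) := [set x | res_H2 x = 1].

End Restriction.

Arguments H2rel {P Q} j A x.

Section Center.
Variable K : groupType.

Definition central : {pred K} := fun z => `[< forall k, z * k = k * z >].

Fact central_group_closed : group_closed central.
Proof.
split=> [|x y /asboolP xP /asboolP yP].
  by apply/asboolP => k; rewrite mul1g mulg1.
apply/asboolP => k; apply: (mulIg y); rewrite -!mulgA -[k * y]yP.
by rewrite mulKg xP mulVg mulg1.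
Qed.

Record center : Type := MkCenter { center_val :> K; centerP : central center_val }.

HB.instance Definition _ := [isSub for center_val].
HB.instance Definition _ := [Choice of center by <:].
HB.instance Definition _ :=
  SubChoice_isSubGroup.Build K central center central_group_closed.

Lemma centerC (z : center) (k : K) : center_val z * k = k * center_val z.
Proof. by case: z => z /= /asboolP; apply. Qed.

Lemma center_comm (x y : center) : x * y = y * x.
Proof. by apply: val_inj; apply: centerC. Qed.

Fact center_res_subproof (f : Aut K) (z : center) : central (f z).
Proof.
apply/asboolP => k; rewrite -[k](aut_invVK f) -!autM.
by congr (f _); apply: centerC.
Qed.

Definition center_res_fun (f : Aut K) (z : center) : center :=
  MkCenter (center_res_subproof f z).

Fact center_res_aut (f : Aut K) : is_aut (center_res_fun f).
Proof.
apply/asboolP; split; first by move=> x y; apply: val_inj; apply: autM.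
exists (center_res_fun f^-1) => x; apply: val_inj.
  exact: aut_invK.
exact: aut_invVK.
Qed.

Definition center_res (f : Aut K) : Aut center := MkAut (center_res_aut f).

(* Inner automorphisms are trivial on the centre, so [Out K] acts on it:
   see [center_outE]. *)
Definition center_out (x : Out K) : Aut center := center_res (qrepr x).

Lemma center_outE (f : Aut K) : center_out (qproj _ f) = center_res f.
Proof.
apply: aut_eqP => z; apply: val_inj => /=.
have [a fa] := qprojP (Inn K) f.
have := fa (center_val z); rewrite autME -centerC mulgK => /(congr1 f).
by rewrite [LHS]aut_invVK.
Qed.

Fact center_out_hom : monoid_morphism center_out.
Proof.
split.
  by rewrite -[1 in LHS]qproj1 center_outE; apply: aut_eqP => z; apply: val_inj.
elim/qprojW=> f; elim/qprojW=> g; rewrite -qprojM !center_outE.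
by apply: aut_eqP => z; apply: val_inj.
Qed.
HB.instance Definition _ := isUMagmaMorphism.Build _ _ center_out center_out_hom.

End Center.

Definition center_module (K Q : groupType) (theta : {hom Q -> Out K}) :
  gmodule Q :=
  GModule (@center_comm K) (@center_out K \o theta : {hom Q -> Aut (center K)}).

Definition is_extension (K G Q : groupType) (i : {hom K -> G})
    (p : {hom G -> Q}) : Prop :=
  [/\ injective i, range p = setT & range i = [set g | p g = 1]].

Record extension (K Q : groupType) := Extension {
  ext_group :> groupType;
  ext_i : {hom K -> ext_group};
  ext_pi : {hom ext_group -> Q};
  extP : is_extension ext_i ext_pi }.

Definition ext_iso (K Q : groupType) (E1 E2 : extension K Q) : Prop :=
  exists phi : {hom E1 -> E2},
    [/\ bijective phi, forall k, phi (ext_i E1 k) = ext_i E2 k &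
        forall g, ext_pi E2 (phi g) = ext_pi E1 g].

Lemma is_extension_inj (K G Q : groupType) (i : {hom K -> G})
  (p : {hom G -> Q}) : is_extension i p -> injective i.
Proof. by case. Qed.

Section ExtensionTheory.
Variables (K Q : groupType) (E : extension K Q).

Lemma ext_i_inj : injective (ext_i E).
Proof. by have [] := extP E. Qed.

Lemma ext_pi_surj q : exists g : E, ext_pi E g = q.
Proof.
have [_ /seteqP[_ /(_ q I)] [g _ <-] _] := extP E; by exists g.
Qed.

Lemma ext_exact (g : E) : (exists k, ext_i E k = g) <-> ext_pi E g = 1.
Proof.
have [_ _ /seteqP[ker1 ker2]] := extP E; split=> [[k ik]|pig].
  by apply: ker1; exists k.
by have [k _ <-] := ker2 _ pig; exists k.
Qed.

Lemma ext_pi_i k : ext_pi E (ext_i E k) = 1.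
Proof. by apply/ext_exact; exists k. Qed.

Lemma ext_conj_exists (g : E) (k : K) :
  exists k', ext_i E k' = g * ext_i E k * g^-1.
Proof. by apply/ext_exact; rewrite !gmulfM ext_pi_i gmulfV mulg1 mulgV. Qed.

Definition ext_conj_fun (g : E) (k : K) : K := sval (cid (ext_conj_exists g k)).

Lemma ext_conj_funE g k : ext_i E (ext_conj_fun g k) = g * ext_i E k * g^-1.
Proof. by rewrite /ext_conj_fun; case: cid. Qed.

Fact ext_conj_aut g : is_aut (ext_conj_fun g).
Proof.
apply/asboolP; split=> [x y|].
  apply: ext_i_inj; rewrite ext_conj_funE !gmulfM !ext_conj_funE.
  by rewrite !mulgA mulgVK.
exists (ext_conj_fun g^-1) => x; apply: ext_i_inj; rewrite !ext_conj_funE.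
  by rewrite invgK !mulgA mulVg mul1g mulgVK.
by rewrite invgK !mulgA mulgV mul1g mulgK.
Qed.

Definition ext_conj (g : E) : Aut K := MkAut (ext_conj_aut g).

Lemma ext_conjE g k : ext_i E (ext_conj g k) = g * ext_i E k * g^-1.
Proof. exact: ext_conj_funE. Qed.

Lemma ext_conjM g h : ext_conj (g * h) = ext_conj g * ext_conj h.
Proof.
apply: aut_eqP => k; apply: ext_i_inj.
by rewrite autME !ext_conjE invgM !mulgA.
Qed.

(* [outer_actionE] shows that the chosen lift of [q] is irrelevant. *)
Definition outer_action_fun (q : Q) : Out K :=
  qproj _ (ext_conj (sval (cid (ext_pi_surj q)))).

Lemma outer_actionE (g : E) : outer_action_fun (ext_pi E g) = qproj _ (ext_conj g).
Proof.
rewrite /outer_action_fun; case: cid => g' /= pig; apply/qproj_eqP.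
have [a ia] : exists a, ext_i E a = g'^-1 * g.
  by apply/ext_exact; rewrite gmulfM gmulfV pig mulVg.
exists a => k; apply: (can_inj (aut_invK (ext_conj g'))).
rewrite autME aut_invVK; apply: ext_i_inj.
rewrite !ext_conjE !gmulfM gmulfV /= !ia.
by rewrite invgM invgK !mulgA mulgV mul1g mulgK.
Qed.

Fact outer_action_hom : monoid_morphism outer_action_fun.
Proof.
have M : {morph outer_action_fun : x y / x * y}.
  move=> x y; have [g <-] := ext_pi_surj x; have [h <-] := ext_pi_surj y.
  by rewrite -gmulfM !outer_actionE ext_conjM qprojM.
split=> //; apply: (mulgI (outer_action_fun 1)).
by rewrite -M !mulg1.
Qed.
HB.instance Definition _ :=
  isUMagmaMorphism.Build _ _ outer_action_fun outer_action_hom.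

Definition outer_action : {hom Q -> Out K} := outer_action_fun.

End ExtensionTheory.

Record extension_with (K Q : groupType) (theta : {hom Q -> Out K}) :=
  ExtensionWith {
    ew_ext :> extension K Q;
    ew_outer : outer_action ew_ext =1 theta }.

(* An isomorphism class is represented by the collection of its members.
   The type of all extensions is too large for [set], hence for [set_bij]:
   plain predicates are used, and [pred_bij] is [set_bij] for them. *)
Definition extension_class (K Q : groupType) (theta : {hom Q -> Out K}) :=
  extension_with theta -> Prop.

Definition iso_class (K Q : groupType) (theta : {hom Q -> Out K})
  (E : extension_with theta) : extension_class theta :=
  fun E' => ext_iso E E'.

Definition iso_classes (K Q : groupType) (theta : {hom Q -> Out K})
  (A : extension_with theta -> Prop) : extension_class theta -> Prop :=
  fun c => exists2 E, A E & iso_class E = c.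

Definition pred_bij (X Y : Type) (A : X -> Prop) (B : Y -> Prop)
    (f : X -> Y) : Prop :=
  [/\ forall x, A x -> B (f x),
      forall x x', A x -> A x' -> f x = f x' -> x = x' &
      forall y, B y -> exists2 x, A x & f x = y].

Section Subextension.
Variables (K P Q : groupType) (j : {hom P -> Q}) (j_inj : injective j).
Variable E : extension K Q.

Definition in_subext : {pred E} := fun g => `[< exists p, j p = ext_pi E g >].

Fact subext_group_closed : group_closed in_subext.
Proof.
split=> [|x y /asboolP[p px] /asboolP[q qy]].
  by apply/asboolP; exists 1; rewrite !gmulf1.
by apply/asboolP; exists (p / q); rewrite !gmulfM !gmulfV px qy.
Qed.

Record subext_group : Type :=
  MkSubext { subext_val :> E; subextP : in_subext subext_val }.

HB.instance Definition _ := [isSub for subext_val].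
HB.instance Definition _ := [Choice of subext_group by <:].
HB.instance Definition _ :=
  SubChoice_isSubGroup.Build E in_subext subext_group subext_group_closed.

Fact subext_i_subproof k : in_subext (ext_i E k).
Proof. by apply/asboolP; exists 1; rewrite ext_pi_i gmulf1. Qed.
Definition subext_i_fun (k : K) : subext_group := MkSubext (subext_i_subproof k).

Fact subext_i_hom : monoid_morphism subext_i_fun.
Proof.
by split=> [|x y]; apply: val_inj; rewrite /= ?gmulf1 ?gmulfM.
Qed.
HB.instance Definition _ := isUMagmaMorphism.Build _ _ subext_i_fun subext_i_hom.

Fact subext_pi_exists (n : subext_group) : exists p, j p = ext_pi E (subext_val n).
Proof. by case: n => n /= /asboolP. Qed.
Definition subext_pi_fun (n : subext_group) : P := sval (cid (subext_pi_exists n)).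

Lemma subext_piE n : j (subext_pi_fun n) = ext_pi E (subext_val n).
Proof. by rewrite /subext_pi_fun; case: cid. Qed.

Fact subext_pi_hom : monoid_morphism subext_pi_fun.
Proof.
by split=> [|x y]; apply: j_inj; rewrite ?gmulf1 ?gmulfM !subext_piE ?gmulf1 ?gmulfM.
Qed.
HB.instance Definition _ := isUMagmaMorphism.Build _ _ subext_pi_fun subext_pi_hom.

Fact subext_is_extension :
  is_extension (subext_i_fun : {hom K -> subext_group})
    (subext_pi_fun : {hom subext_group -> P}).
Proof.
split.
- by move=> x y /(congr1 subext_val) /ext_i_inj.
- apply/seteqP; split=> // p _; have [g gp] := ext_pi_surj E (j p).
  have gN : in_subext g by apply/asboolP; exists p.
  by exists (MkSubext gN) => //; apply: j_inj; rewrite subext_piE.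
apply/seteqP; split=> [_ [k _ <-]|n /= n1].
  by apply: j_inj; rewrite subext_piE /= ext_pi_i gmulf1.
have [k kn] : exists k, ext_i E k = subext_val n.
  by apply/ext_exact; rewrite -subext_piE n1 gmulf1.
by exists k => //; apply: val_inj.
Qed.

Definition subextension : extension K P := Extension subext_is_extension.

End Subextension.

(* [e] is kept as an argument of the carrier because the group structure
   depends on it. *)
Definition boxtimes_group (K Q : groupType) (theta : {hom Q -> Out K})
  (e : Z2 (center_module theta)) (E : extension_with theta) : Type := E.

Section Boxtimes.
Variables (K Q : groupType) (theta : {hom Q -> Out K}).
Variables (e : Z2 (center_module theta)) (E : extension_with theta).
Local Notation p := (ext_pi E).
Local Notation twE := (boxtimes_group e E).

Definition ext_iZ (z : center_module theta) : E := ext_i E (center_val z).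

Lemma ext_iZM z w : ext_iZ (z * w) = ext_iZ z * ext_iZ w.
Proof. exact: gmulfM. Qed.
Lemma ext_iZV z : ext_iZ z^-1 = (ext_iZ z)^-1.
Proof. exact: (gmulfV (ext_i E) (center_val z)). Qed.
Lemma ext_iZ1 : ext_iZ 1 = 1.
Proof. exact: gmulf1. Qed.
Lemma ext_piZ z : p (ext_iZ z) = 1.
Proof. exact: ext_pi_i. Qed.

Lemma ext_iZ_act (g : E) z : g * ext_iZ z = ext_iZ (act (p g) z) * g.
Proof.
have -> : ext_iZ (act (p g) z) = ext_i E (ext_conj g (center_val z)).
  have th : center_out (theta (p g)) = center_res (ext_conj g).
    by rewrite -(ew_outer E) -center_outE; congr center_out; apply: outer_actionE.
  by rewrite /ext_iZ /act [gm_act _ _]th.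
by rewrite ext_conjE mulgVK.
Qed.

Definition boxtimes_mul (g1 g2 : twE) : twE :=
  ext_iZ (e (p g1) (p g2)) * g1 * g2.
Definition boxtimes_one : twE := (1 : E).
Definition boxtimes_inv (g : twE) : twE :=
  (ext_iZ (e (p g)^-1 (p g)))^-1 * (g : E)^-1.

Lemma boxtimes_pi g1 g2 : p (boxtimes_mul g1 g2) = p g1 * p g2.
Proof. by rewrite !gmulfM ext_piZ mul1g. Qed.

Lemma boxtimes_piV g : p (boxtimes_inv g) = (p g)^-1.
Proof. by rewrite gmulfM !gmulfV ext_piZ invg1 mul1g. Qed.

Fact boxtimes_mulA : associative boxtimes_mul.
Proof.
move=> x y z; rewrite {1 3}/boxtimes_mul !boxtimes_pi /boxtimes_mul.
rewrite -[_ * x * _]mulgA 2!(mulgA x) ext_iZ_act !mulgA -!ext_iZM.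
by rewrite (gm_comm (e _ _)) -z2E (gm_comm (e _ _)).
Qed.
Fact boxtimes_mul1 : left_id boxtimes_one boxtimes_mul.
Proof. by move=> x; rewrite /boxtimes_mul gmulf1 z21l ext_iZ1 !mul1g. Qed.
Fact boxtimes_1mul : right_id boxtimes_one boxtimes_mul.
Proof. by move=> x; rewrite /boxtimes_mul gmulf1 z21r ext_iZ1 mulg1 mul1g. Qed.
Fact boxtimes_mulV : left_inverse boxtimes_one boxtimes_inv boxtimes_mul.
Proof.
move=> x; rewrite /boxtimes_mul boxtimes_piV /boxtimes_inv !mulgA.
by rewrite mulgV mul1g mulVg.
Qed.
Fact boxtimes_Vmul : right_inverse boxtimes_one boxtimes_inv boxtimes_mul.
Proof.
move=> x; rewrite /boxtimes_mul boxtimes_piV /boxtimes_inv.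
rewrite -ext_iZV -mulgA (mulgA (x : E)) ext_iZ_act mulgK -ext_iZM.
have := z2E e (p x) (p x)^-1 (p x).
rewrite mulgV mulVg z21l z21r !mulg1 => ->.
by rewrite actV mulgV ext_iZ1.
Qed.

HB.instance Definition _ := Choice.on twE.
HB.instance Definition _ := isGroup.Build twE
  boxtimes_mulA boxtimes_mul1 boxtimes_1mul boxtimes_mulV boxtimes_Vmul.

Definition boxtimes_i_fun (k : K) : twE := ext_i E k.
Definition boxtimes_pi_fun (g : twE) : Q := p g.

Lemma boxtimesE (x y : twE) : x * y = boxtimes_mul x y.
Proof. by []. Qed.

Fact boxtimes_i_hom : monoid_morphism boxtimes_i_fun.
Proof.
split; first by rewrite /boxtimes_i_fun gmulf1.
move=> x y; rewrite boxtimesE /boxtimes_mul /boxtimes_i_fun !ext_pi_i z21l.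
by rewrite ext_iZ1 mul1g gmulfM.
Qed.
HB.instance Definition _ :=
  isUMagmaMorphism.Build _ _ boxtimes_i_fun boxtimes_i_hom.

Fact boxtimes_pi_hom : monoid_morphism boxtimes_pi_fun.
Proof. by split; [exact: gmulf1 | exact: boxtimes_pi]. Qed.
HB.instance Definition _ :=
  isUMagmaMorphism.Build _ _ boxtimes_pi_fun boxtimes_pi_hom.

Fact boxtimes_is_extension :
  is_extension (boxtimes_i_fun : {hom K -> twE})
    (boxtimes_pi_fun : {hom twE -> Q}).
Proof. by have [ii ss ee] := extP E; split. Qed.

Definition boxtimes_ext : extension K Q := Extension boxtimes_is_extension.

Lemma boxtimes_conj (g : E) : @ext_conj _ _ boxtimes_ext g = ext_conj g.
Proof.
apply: aut_eqP => k; apply: (@ext_i_inj _ _ boxtimes_ext).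
rewrite ext_conjE; apply: (mulIg (g : boxtimes_ext)); rewrite mulgVK.
rewrite /= !boxtimesE /boxtimes_mul /= /boxtimes_i_fun !ext_pi_i.
by rewrite z21l z21r ext_iZ1 !mul1g ext_conjE mulgVK.
Qed.

Fact boxtimes_outer : outer_action boxtimes_ext =1 theta.
Proof.
move=> q; have [g <-] := ext_pi_surj E q.
rewrite -(ew_outer E) /= (@outer_actionE _ _ boxtimes_ext) outer_actionE.
by rewrite boxtimes_conj.
Qed.

Definition boxtimes : extension_with theta := ExtensionWith boxtimes_outer.

End Boxtimes.

Lemma ext_iso_sym (K Q : groupType) (E1 E2 : extension K Q) :
  ext_iso E1 E2 -> ext_iso E2 E1.
Proof.
move=> [f [[g fg gf] fi fp]].
have gM : monoid_morphism g.
  split; first by apply: (can_inj fg); rewrite gf gmulf1.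
  by move=> x y; apply: (can_inj fg); rewrite gmulfM !gf.
pose gB := isUMagmaMorphism.Build _ _ g gM.
pose gh : {hom E2 -> E1} := HB.pack g gB.
exists gh; split=> [|k|x]; first by exists f.
- by rewrite -fi /= fg.
by rewrite -[in RHS](gf x) fp.
Qed.

Lemma ext_iso_trans (K Q : groupType) (E1 E2 E3 : extension K Q) :
  ext_iso E1 E2 -> ext_iso E2 E3 -> ext_iso E1 E3.
Proof.
move=> [f [fb fi fp]] [g [gb gi gp]].
exists (g \o f : {hom E1 -> E3}).
by split=> [|k|x] /=; [exact: bij_comp | rewrite fi gi | rewrite gp fp].
Qed.

Section BoxtimesClass.
Variables (K Q : groupType) (theta : {hom Q -> Out K}).
Variable E : extension_with theta.

(* [boxtimes_classE] shows that the representative is irrelevant. *)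
Definition boxtimes_class (x : H2 (center_module theta)) :
  extension_class theta := iso_class (boxtimes (qrepr x) E).

Lemma boxtimes_cohomologous (d e : Z2 (center_module theta)) :
  B2 _ (d^-1 * e) -> ext_iso (boxtimes e E) (boxtimes d E).
Proof.
move=> [z [z1 dez]].
pose f (g : boxtimes_group e E) : boxtimes_group d E :=
  ext_iZ E (z (ext_pi E g)) * g.
have pif g : ext_pi E (f g) = ext_pi E g by rewrite gmulfM ext_piZ mul1g.
have key (u v : E) (a := ext_pi E u) (b := ext_pi E v) :
    ext_iZ E (z (a * b)) * (ext_iZ E (e a b) * u * v) =
    ext_iZ E (d a b) * (ext_iZ E (z a) * u) * (ext_iZ E (z b) * v).
  have -> : e a b = d a b * (z a * act a (z b) * (z (a * b))^-1).
    by rewrite -dez z2M z2V mulVKg.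
  rewrite !mulgA -(mulgA _ u (ext_iZ E _)) (ext_iZ_act u) -/a !mulgA -!ext_iZM.
  by rewrite (gm_comm (z (a * b))) mulgVK.
have fM : monoid_morphism f.
  split; first by rewrite /f gmulf1 z1 ext_iZ1 mulg1.
  move=> x y; rewrite [RHS]boxtimesE /boxtimes_mul !pif /f boxtimes_pi.
  exact: key.
pose fB := isUMagmaMorphism.Build _ _ f fM.
pose fh : {hom boxtimes e E -> boxtimes d E} := HB.pack f fB.
exists fh; split=> [|k|g].
- exists (fun g : boxtimes_group d E => (ext_iZ E (z (ext_pi E g)))^-1 * g) => g /=.
    by rewrite /f gmulfM ext_piZ mul1g mulKg.
  by rewrite /f gmulfM gmulfV ext_piZ invg1 mul1g mulVKg.
- by rewrite /= /f /boxtimes_i_fun ext_pi_i z1 ext_iZ1 mul1g.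
exact: pif.
Qed.

Lemma boxtimes_classE (e : Z2 (center_module theta)) :
  boxtimes_class (qproj _ e) = iso_class (boxtimes e E).
Proof.
have iso := boxtimes_cohomologous (qprojP (B2 _) e).
apply: funext => F; apply: propext; split; last exact: ext_iso_trans.
exact: ext_iso_trans (ext_iso_sym iso).
Qed.

End BoxtimesClass.

(* Main.v *)
Require Import Defs.
From HB Require Import structures.
From mathcomp Require Import all_boot.
From mathcomp Require Import boolp classical_sets functions.

Set Implicit Arguments.
Unset Strict Implicit.
Unset Printing Implicit Defensive.

Local Open Scope group_scope.

(** Twisting [G] by cocycles reaches every extension because two extensions
    [G] and [E] with the same outer action can be compared elementwise.
    Elements of [G] and [E] over the same element of [Q] conjugate [K] in the
    same way up to an inner automorphism, so lifts can be chosen whose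
    conjugations agree exactly; this gives a map [f : G -> E] over [Q] that
    commutes with left translation by [K] and preserves the conjugation of
    [K] ([comparison_exists]).  Then [f x * f y] and [f (x * y)] have the same
    image in [Q] and the same conjugation, so they differ by an element of the
    centre of [K] ([ext_iZ_exists]).  That element depends only on the images
    of [x] and [y] in [Q], it is a cocycle [e] by associativity in [E], and by
    construction [f] is an isomorphism from the twist of [G] by [e] onto [E]
    ([boxtimes_exhaustive]).

    For injectivity, and for the subgroup of classes that vanish on [P], the
    question is when the [P]-subextensions of two twists of [G], by [e] and by
    [d], are isomorphic.  An isomorphism preserves images in [P] and
    conjugations, so it moves each element by a central factor, which depends
    only on the image in [P]: it has the form [n |-> z (pi n) * n].  Such a
    map is multiplicative exactly when the restriction to [P] of [d^-1 * e] is
    the coboundary of [z] ([boxtimes_subext_iso]).  With [P = Q] this says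
    that isomorphic twists come from cohomologous cocycles; with [d = 1] it
    says that the [P]-subextension of the twist by [e] is isomorphic to that
    of [G] exactly when the class of [e] restricts to zero on [P].  The second
    bijection is then the restriction of the first. *)

(** * Morphisms of extensions *)

Lemma ext_pi_eqP (K Q : groupType) (E : extension K Q) (g h : E) :
  ext_pi E g = ext_pi E h -> exists k, g = ext_i E k * h.
Proof.
move=> gh; have [k kE] : exists k, ext_i E k = g * h^-1.
  by apply/ext_exact; rewrite gmulfM gmulfV gh mulgV.
by exists k; rewrite kE mulgVK.
Qed.

Lemma ext_conj_comm (K Q : groupType) (E : extension K Q) (g : E) k :
  g * ext_i E k = ext_i E (ext_conj g k) * g.
Proof. by rewrite ext_conjE mulgVK. Qed.

Lemma ext_conj1 (K Q : groupType) (E : extension K Q) :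
  ext_conj (1 : E) = 1.
Proof. by apply: (mulgI (ext_conj (1 : E))); rewrite -ext_conjM !mulg1. Qed.

Lemma ext_conj_i (K Q : groupType) (E : extension K Q) a k :
  ext_conj (ext_i E a) k = a * k * a^-1.
Proof. by apply: (@ext_i_inj _ _ E); rewrite ext_conjE !gmulfM gmulfV. Qed.

(** The short five lemma: a multiplicative map that is the identity on the
    kernel and on the quotient is bijective, so isomorphisms of extensions can
    be given without an inverse. *)
Lemma ext_iso_of_morph (K Q : groupType) (E1 E2 : extension K Q)
    (f : E1 -> E2) :
  {morph f : x y / x * y} -> (forall k, f (ext_i E1 k) = ext_i E2 k) ->
  (forall g, ext_pi E2 (f g) = ext_pi E1 g) -> ext_iso E1 E2.
Proof.
move=> fM fi fp.
have f1 : f 1 = 1 by rewrite -[in LHS](gmulf1 (s := ext_i E1)) fi gmulf1.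
pose fB := isUMagmaMorphism.Build _ _ f (conj f1 fM).
pose fh : {hom E1 -> E2} := HB.pack f fB.
exists fh; split=> //; rewrite -setTT_bijective; split=> //=.
- move=> x y _ _ fxy.
  have [k xE] : exists k, x = ext_i E1 k * y.
    by apply: ext_pi_eqP; rewrite -!fp /= fxy.
  move: fxy; rewrite xE /= fM fi => /(canRL (mulgK _)).
  rewrite mulgV -(gmulf1 (s := ext_i E2)) => /ext_i_inj ->.
  by rewrite gmulf1 mul1g.
- move=> h _; have [g gh] := ext_pi_surj E1 (ext_pi E2 h).
  have [k hE] : exists k, h = ext_i E2 k * f g by apply: ext_pi_eqP; rewrite fp.
  by exists (ext_i E1 k * g) => //=; rewrite fM fi.
Qed.

Lemma ext_iso_refl (K Q : groupType) (E : extension K Q) : ext_iso E E.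
Proof. exact: (@ext_iso_of_morph _ _ _ _ id). Qed.

Lemma ext_iso_conj (K Q : groupType) (E1 E2 : extension K Q)
    (phi : {hom E1 -> E2}) :
  (forall k, phi (ext_i E1 k) = ext_i E2 k) ->
  forall g, ext_conj (phi g) = ext_conj g.
Proof.
move=> phii g; apply: aut_eqP => k; apply: (@ext_i_inj _ _ E2).
by rewrite ext_conjE -!phii ext_conjE !gmulfM gmulfV.
Qed.

(** * Elements with the same image and the same conjugation *)

Section CentralDifference.
Variables (K Q : groupType) (theta : {hom Q -> Out K}).
Variable E : extension_with theta.

Lemma ext_iZ_inj : injective (@ext_iZ _ _ _ E).
Proof. by move=> z w /ext_i_inj /val_inj. Qed.

Lemma ext_iZC (z : center_module theta) k :
  ext_i E k * ext_iZ E z = ext_iZ E z * ext_i E k.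
Proof. by rewrite /ext_iZ -!gmulfM centerC. Qed.

(** The kernel element [a] with [g = a * h] acts trivially on [K] by
    conjugation, as [g] and [h] act alike and [ext_conj h] is onto. *)
Lemma ext_iZ_exists (g h : E) :
  ext_pi E g = ext_pi E h -> ext_conj g = ext_conj h ->
  exists z : center_module theta, g = ext_iZ E z * h.
Proof.
move=> /ext_pi_eqP[a gE] ghJ.
have aZ : central a.
  apply/asboolP => k; rewrite -[k](aut_invVK (ext_conj h)).
  set m := aut_inv _ k; apply: (@ext_i_inj _ _ E); apply: (mulIg h).
  rewrite !gmulfM -mulgA -ext_conj_comm -ghJ -[RHS]mulgA -gE -ext_conj_comm.
  by rewrite gE mulgA.
by exists (MkCenter aZ).
Qed.

End CentralDifference.

(** * Every extension is a twist of a given one *)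

Section Comparison.
Variables (K Q : groupType) (theta : {hom Q -> Out K}).
Variables G E : extension_with theta.

(** Any lift acts as [g] does up to an inner automorphism, since the two
    outer actions agree; correcting it by an element of [K] removes that
    automorphism. *)
Lemma conj_lift_exists (g : G) : exists h : E,
  ext_pi E h = ext_pi G g /\ ext_conj h = ext_conj g.
Proof.
have [h hg] := ext_pi_surj E (ext_pi G g).
have /qproj_eqP[a aE] : qproj (Inn K) (ext_conj h) = qproj (Inn K) (ext_conj g).
  by rewrite -!outer_actionE hg [LHS](ew_outer E) [RHS](ew_outer G).
exists (h * ext_i E a); split; first by rewrite gmulfM ext_pi_i mulg1.
apply: aut_eqP => k; rewrite ext_conjM autME.
by rewrite ext_conj_i -aE autME; apply: aut_invVK.
Qed.

(** Each element of [G] is uniquely [k * s q] for a section [s], and [f] sends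
    it to [k * t q], where [t q] is a lift to [E] that conjugates [K] as [s q]
    does.  Taking [s 1 = t 1 = 1] makes [f] the identity on [K] and the
    resulting cocycle normalized. *)
Lemma comparison_exists : exists f : G -> E,
  [/\ forall k g, f (ext_i G k * g) = ext_i E k * f g,
      f 1 = 1,
      forall g, ext_pi E (f g) = ext_pi G g &
      forall g, ext_conj (f g) = ext_conj g].
Proof.
(* [s q] is the pair of the two chosen lifts of [q]. *)
have /choice[s sP] : forall q, exists s : G * E,
    [/\ ext_pi G s.1 = q, ext_pi E s.2 = q,
        ext_conj s.2 = ext_conj s.1 & q = 1 -> s = (1, 1)].
  move=> q; have [->|q1] := pselect (q = 1).
    exists (1, 1); split=> //=; rewrite ?gmulf1 //.
    by rewrite !ext_conj1.
  have [g gq] := ext_pi_surj G q; have [h [hg hJ]] := conj_lift_exists g.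
  by exists (g, h); split=> //=; rewrite hg.
have fP g : exists kg : K, g = ext_i G kg * (s (ext_pi G g)).1.
  by apply: ext_pi_eqP; have [-> _ _ _] := sP (ext_pi G g).
have [c cP] := choice fP.
pose f g := ext_i E (c g) * (s (ext_pi G g)).2.
exists f; split=> [k g||g|g].
- rewrite /f gmulfM ext_pi_i mul1g mulgA -gmulfM; congr (ext_i E _ * _).
  apply: (@ext_i_inj _ _ G); apply: (mulIg (s (ext_pi G g)).1).
  by have := cP (ext_i G k * g); rewrite gmulfM ext_pi_i mul1g => <-;
    rewrite gmulfM -mulgA -cP.
- rewrite /f gmulf1; have [_ _ _ ->//] := sP 1; rewrite mulg1.
  have := cP 1; rewrite gmulf1; have [_ _ _ ->//] := sP 1.
  rewrite mulg1 -[1 in LHS](gmulf1 (s := ext_i G)) => /ext_i_inj <-.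
  by rewrite gmulf1.
- by rewrite gmulfM ext_pi_i mul1g; have [_ -> _ _] := sP (ext_pi G g).
- rewrite [in RHS](cP g) !ext_conjM; have [_ _ -> _] := sP (ext_pi G g).
  by congr (_ * _); apply: aut_eqP => k; rewrite !ext_conj_i.
Qed.

(** The defect of multiplicativity of the comparison map is the cocycle. *)
Lemma boxtimes_exhaustive :
  exists e : Z2 (center_module theta), ext_iso (boxtimes e G) E.
Proof.
have [f [fK f1 fp fJ]] := comparison_exists.
pose A := center_module theta.
have fi k : f (ext_i G k) = ext_i E k by rewrite -[ext_i G k]mulg1 fK f1 mulg1.
have fZ (z : A) g : f (ext_iZ G z * g) = ext_iZ E z * f g by apply: fK.
have dP x y : exists z : A, f x * f y = ext_iZ E z * f (x * y).
  apply: ext_iZ_exists; rewrite ?gmulfM ?fp ?gmulfM//.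
  by rewrite ext_conjM !fJ ext_conjM.
have [s sP] := choice (ext_pi_surj G).
have [d dE] : exists d : Q -> Q -> A, forall x y,
    f x * f y = ext_iZ E (d (ext_pi G x) (ext_pi G y)) * f (x * y).
  have /choice[d dE] : forall ab : Q * Q, exists z : A,
      f (s ab.1) * f (s ab.2) = ext_iZ E z * f (s ab.1 * s ab.2).
    by move=> ab; apply: dP.
  exists (fun a b => d (a, b)) => x y.
  (* Writing [x] and [y] as elements of [K] times chosen lifts, the factors
     from [K] come out of both sides in the same way, because [f] preserves
     the conjugation of [K]; only the defect at the lifts remains. *)
  have [k xE] := ext_pi_eqP (esym (sP (ext_pi G x))).
  have [l yE] := ext_pi_eqP (esym (sP (ext_pi G y))).
  set a := ext_pi G x in xE *; set b := ext_pi G y in yE *.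
  have xyE : x * y = ext_i G (k * ext_conj (s a) l) * (s a * s b).
    rewrite xE yE gmulfM !mulgA -[in LHS](mulgA _ (s a)).
    by rewrite ext_conj_comm !mulgA.
  rewrite xyE fK mulgA -ext_iZC -mulgA -(dE (a, b)) /= {1}xE {1}yE !fK gmulfM.
  rewrite !mulgA; congr (_ * _); rewrite -!mulgA; congr (_ * _).
  by rewrite ext_conj_comm fJ.
have dZ : cocycle2 d.
  apply/asboolP; split=> [a|a|a b c].
  - apply: (@ext_iZ_inj _ _ _ E); apply: (mulIg (f (s a))).
    by have := dE 1 (s a); rewrite gmulf1 sP f1 !mul1g ext_iZ1 mul1g => <-.
  - apply: (@ext_iZ_inj _ _ _ E); apply: (mulIg (f (s a))).
    by have := dE (s a) 1; rewrite gmulf1 sP f1 !mulg1 ext_iZ1 mul1g => <-.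
  (* Both sides are the defect of [f] on a triple product, bracketed in the
     two possible ways. *)
  apply: (@ext_iZ_inj _ _ _ E).
  apply: (mulIg (f (s a * s b * s c))).
  have L := dE (s a * s b) (s c); have R := dE (s a) (s b * s c).
  have := mulgA (f (s a)) (f (s b)) (f (s c)).
  rewrite !dE mulgA ext_iZ_act fp -!mulgA L R !gmulfM !sP !mulgA.
  by rewrite !ext_iZM => ->.
exists (MkZ2 dZ); apply: (@ext_iso_of_morph _ _ (boxtimes _ G) E f) => //.
by move=> x y; rewrite dE -fZ boxtimesE /boxtimes_mul mulgA.
Qed.

End Comparison.

(** * Subextensions of twists *)

Section Restriction.
Variables (K P Q : groupType) (j : {hom P -> Q}) (j_inj : injective j).

Lemma subext_conj (E : extension K Q) (n : subextension j_inj E) :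
  ext_conj n = ext_conj (subext_val n).
Proof.
apply: aut_eqP => k; apply: (@ext_i_inj _ _ E).
by rewrite ext_conjE; have /(congr1 (@subext_val _ _ _ _ _)) := ext_conjE n k.
Qed.

Lemma subext_lift (E : extension K Q) (x : E) p :
  ext_pi E x = j p -> exists n : subextension j_inj E,
    subext_val n = x /\ ext_pi (subextension j_inj E) n = p.
Proof.
move=> xp; have xN : in_subext j x by apply/asboolP; exists p.
by exists (MkSubext xN); split=> //; apply: j_inj; rewrite subext_piE.
Qed.

Lemma subext_iso (E1 E2 : extension K Q) :
  ext_iso E1 E2 -> ext_iso (subextension j_inj E1) (subextension j_inj E2).
Proof.
move=> [phi [_ phii phip]].
have phiN (n : subextension j_inj E1) : in_subext j (phi (subext_val n)).
  by apply/asboolP; exists (ext_pi _ n); rewrite phip subext_piE.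
apply: (@ext_iso_of_morph _ _ (subextension j_inj E1) (subextension j_inj E2)
  (fun n => MkSubext (phiN n))).
- by move=> x y; apply: val_inj; rewrite /= gmulfM.
- by move=> k; apply: val_inj; apply: phii.
by move=> n; apply: j_inj; rewrite !subext_piE /= phip.
Qed.

Variables (theta : {hom Q -> Out K}) (G : extension_with theta).
Implicit Types d e : Z2 (center_module theta).
Local Notation sub e := (subextension j_inj (boxtimes e G)).

(** The left-hand side compares the two sides of the multiplicativity of
    [x |-> z * x], from the product twisted by [e] to the one twisted by [d];
    both are central multiples of [x * y], so that [x] and [y] cancel and only
    the coboundary condition is left. *)
Lemma boxtimes_shift_morph d e (z : P -> center_module theta) p q (x y : G) :
  ext_pi G x = j p -> ext_pi G y = j q ->
  (ext_iZ G (z (p * q)) * (ext_iZ G (e (j p) (j q)) * x * y) =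
   ext_iZ G (d (j p) (j q)) * (ext_iZ G (z p) * x) * (ext_iZ G (z q) * y)) <->
  (d (j p) (j q))^-1 * e (j p) (j q) =
    z p * act (j p) (z q) * (z (p * q))^-1.
Proof.
move=> xp yq.
have -> : ext_iZ G (d (j p) (j q)) * (ext_iZ G (z p) * x) * (ext_iZ G (z q) * y)
    = ext_iZ G (d (j p) (j q) * (z p * act (j p) (z q))) * (x * y).
  by rewrite !ext_iZM -xp !mulgA -(mulgA _ x) (ext_iZ_act x) !mulgA.
have -> : ext_iZ G (z (p * q)) * (ext_iZ G (e (j p) (j q)) * x * y)
    = ext_iZ G (z (p * q) * e (j p) (j q)) * (x * y) by rewrite ext_iZM !mulgA.
split=> [/mulIg /ext_iZ_inj H|H].
  apply: (mulIg (z (p * q))).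
  by rewrite mulgVK -mulgA (gm_comm (e _ _)) H mulKg.
congr (ext_iZ G _ * _); apply: (mulgI (d (j p) (j q))^-1).
by rewrite mulKg (gm_comm (z _)) mulgA H mulgVK.
Qed.

(** As the twist keeps the elements of [G] and changes their product, an
    element of a subextension of a twist can be read in [G] itself, where the
    elements of different twists can be multiplied together. *)
Definition underlying e (n : sub e) : G := subext_val n.

Lemma underlyingM e (m n : sub e) :
  underlying (m * n) =
  ext_iZ G (e (j (ext_pi (sub e) m)) (j (ext_pi (sub e) n))) *
  underlying m * underlying n.
Proof. by rewrite [X in e X](subext_piE m) [X in e _ X](subext_piE n). Qed.

Lemma underlying_pi e (n : sub e) :
  ext_pi G (underlying n) = j (ext_pi (sub e) n).
Proof. exact: esym (subext_piE n). Qed.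

Lemma underlying_i e k : underlying (ext_i (sub e) k) = ext_i G k.
Proof. by []. Qed.

Lemma underlying_conj e (n : sub e) : ext_conj (underlying n) = ext_conj n.
Proof. by rewrite -(boxtimes_conj e) [RHS]subext_conj. Qed.

Lemma underlying_iM e k (n : sub e) :
  underlying (ext_i (sub e) k * n) = ext_i G k * underlying n.
Proof. by rewrite underlyingM ext_pi_i gmulf1 z21l ext_iZ1 mul1g. Qed.

(** Isomorphisms between the two subextensions are exactly the translations
    [n |-> z (pi n) * n] by a cochain [z] whose coboundary is the restriction
    of [d^-1 * e]. *)
Lemma boxtimes_subext_iso d e :
  ext_iso (sub e) (sub d) <-> B2 _ (res_Z2 j (d^-1 * e)).
Proof.
split=> [[phi [_ phii phip]]|[z [z1 zE]]].
  have phi_pi n : ext_pi G (underlying (phi n)) = ext_pi G (underlying n).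
    by rewrite !underlying_pi phip.
  have phi_conj n : ext_conj (underlying (phi n)) = ext_conj (underlying n).
    by rewrite !underlying_conj; apply: ext_iso_conj.
  have [s sP] := choice (ext_pi_surj (sub e)).
  have [z zE] :=
    choice (fun p => ext_iZ_exists (phi_pi (s p)) (phi_conj (s p))).
  have phiE n :
      underlying (phi n) = ext_iZ G (z (ext_pi (sub e) n)) * underlying n.
    (* [n] is an element of [K] times the chosen lift, and central factors
       pass through [K], so that the factor of the lift is that of [n]. *)
    have [k nE] := ext_pi_eqP (esym (sP (ext_pi _ n))).
    by rewrite {1 3}nE gmulfM phii !underlying_iM zE !mulgA ext_iZC.
  exists z; split=> [|p q].
    apply: (@ext_iZ_inj _ _ _ G); have := phiE 1.
    rewrite !gmulf1 -(gmulf1 (s := ext_i (sub e))).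
    rewrite -(gmulf1 (s := ext_i (sub d))) !underlying_i !gmulf1.
    by rewrite mulg1 ext_iZ1.
  have lift r : ext_pi G (underlying (s r)) = j r by rewrite underlying_pi sP.
  apply/(boxtimes_shift_morph d e z (lift p) (lift q)).
  have := phiE (s p * s q); rewrite !gmulfM !sP !underlyingM !phip !sP => <-.
  by rewrite -!zE.
pose f (n : sub e) : G := ext_iZ G (z (ext_pi (sub e) n)) * underlying n.
have fp n : ext_pi G (f n) = j (ext_pi (sub e) n).
  by rewrite gmulfM ext_piZ mul1g underlying_pi.
have [phi phiE] := choice (fun n => subext_lift (E := boxtimes d G) (fp n)).
apply: (@ext_iso_of_morph _ _ (sub e) (sub d) phi).
- move=> m n; apply: val_inj; rewrite -[RHS]/(underlying (phi m * phi n)).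
  rewrite underlyingM [underlying (phi m)](phiE _).1.
  rewrite [underlying (phi n)](phiE _).1 [LHS](phiE _).1 !(phiE _).2.
  rewrite /f underlyingM gmulfM.
  by apply/(boxtimes_shift_morph d e z); rewrite ?underlying_pi//; apply: zE.
- move=> k; apply: val_inj; rewrite [LHS](phiE _).1 /f ext_pi_i z1 ext_iZ1.
  by rewrite mul1g underlying_i.
- by move=> n; rewrite (phiE n).2.
Qed.

End Restriction.

(** * Isomorphism classes of twists *)

Section Classification.
Variables (K Q : groupType) (theta : {hom Q -> Out K}).
Variable G : extension_with theta.
Local Notation A := (center_module theta).

Lemma boxtimes1_iso : ext_iso (boxtimes (1 : Z2 A) G) G.
Proof.
apply: (@ext_iso_of_morph _ _ (boxtimes (1 : Z2 A) G) G id) => // x y.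
by rewrite boxtimesE /boxtimes_mul ext_iZ1 mul1g.
Qed.

(** The case of the subgroup [Q] of itself: an isomorphism of extensions
    restricts to the subextensions over [Q]. *)
Lemma boxtimes_iso d e :
  ext_iso (boxtimes e G) (boxtimes d G) <-> B2 A (d^-1 * e).
Proof.
split; last exact: boxtimes_cohomologous.
have id_inj : injective (idfun : {hom Q -> Q}) by [].
by move=> /(subext_iso id_inj) /boxtimes_subext_iso.
Qed.

Lemma iso_class_eqP (E F : extension_with theta) :
  iso_class E = iso_class F <-> ext_iso E F.
Proof.
split=> EF.
  by rewrite -[ext_iso E F]/(iso_class E F) EF; apply: ext_iso_refl.
apply: funext => H; apply: propext; split; apply: ext_iso_trans => //.
exact: ext_iso_sym.
Qed.

End Classification.

Theorem theorem13p1 (K P Q R : groupType)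
    (jbar : {hom P -> Q}) (phibar : {hom Q -> R})
    (PQR : is_extension jbar phibar)
    (theta : {hom Q -> Out K}) (G : extension_with theta) :
  let j_inj := is_extension_inj PQR in
  let N := subextension j_inj G in
  pred_bij (fun _ : H2 (center_module theta) => True)
    (iso_classes (fun _ : extension_with theta => True))
    (boxtimes_class G) /\
  pred_bij (H2rel jbar (center_module theta))
    (iso_classes
       (fun E : extension_with theta => ext_iso (subextension j_inj E) N))
    (boxtimes_class G).
Proof.
move=> j_inj N.
have inj : injective (boxtimes_class G).
  elim/qprojW=> d; elim/qprojW=> e; rewrite !boxtimes_classE => /iso_class_eqP.
  by move=> /ext_iso_sym /boxtimes_iso /qproj_eqP.
have surj (E : extension_with theta) :
    exists x, boxtimes_class G x = iso_class E.
  have [e eE] := boxtimes_exhaustive G E.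
  by exists (qproj _ e); rewrite boxtimes_classE; apply/iso_class_eqP.
have relP e : H2rel jbar _ (qproj _ e) <->
    ext_iso (subextension j_inj (boxtimes e G)) N.
  have subG : ext_iso (subextension j_inj (boxtimes 1 G)) N.
    exact: subext_iso (boxtimes1_iso G).
  rewrite /H2rel /= res_H2E; split=> [/esym|iso].
    rewrite -qproj1 => /qproj_eqP eB; apply: ext_iso_trans subG.
    apply/boxtimes_subext_iso.
    by move: eB; rewrite !invg1 !mul1g.
  apply/esym; rewrite -qproj1; apply/qproj_eqP.
  have /boxtimes_subext_iso := ext_iso_trans iso (ext_iso_sym subG).
  by rewrite !invg1 !mul1g.
split; split.
- by move=> x _; exists (boxtimes (qrepr x) G).
- by move=> x y _ _; apply: inj.
- by move=> _ [E _ <-]; have [x xE] := surj E; exists x.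
- elim/qprojW=> e /relP eN; exists (boxtimes e G) => //.
  by rewrite boxtimes_classE.
- by move=> x y _ _; apply: inj.
- move=> _ [E EN <-]; have [x xE] := surj E; exists x => //.
  elim/qprojW: x xE => e; rewrite boxtimes_classE => /iso_class_eqP eE.
  by apply/relP; apply: ext_iso_trans EN; apply: subext_iso.
Qed.
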